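(* Let $\psi$ be a bounded complexity measure, $A$ a nonempty closed class of decision tables from $\mathcal{M}_k^2$, and suppose $F_{\psi,A}$ is defined everywhere on $\omega$. Then there exists a polynomial $p_0$ with $F_{\psi,A}(n)\le p_0(n)$ for all $n\in\omega$ if and only if there exist polynomials $p_1,p_2$ with $S_{\psi,A}(n)\le p_1(n)$ and $N_{\psi,A}(n)\le 2^{p_2(n)}$ for all $n\in\omega$.
   Context: Fix an integer $k\ge 2$; $\omega=\{0,1,2,\ldots\}$, $E_k=\{0,1,\ldots,k-1\}$, $E_2=\{0,1\}$. Let $P=\{f_i:i\in\omega\}$ be a set of attribute names ($f_i\ne f_j$ for $i\ne j$). $\mathcal{M}_k^2$ is the set of rectangular tables filled with numbers from $E_k$ whose columns are labeled with pairwise different attributes from $P$, whose rows are pairwise different, and in which each row is labeled with a decision from $E_2$. Tables without rows also belong to $\mathcal{M}_k^2$ and are all denoted $\Lambda$. Tables differing only by a permutation of rows are equal. $P(T)$ is the set of column attributes. $\mathcal{M}_k^2\mathcal{C}$ is the set of tables in which all rows have the same decision ($\Lambda$ included). $T(f_{i_1},\delta_1)\cdots(f_{i_m},\delta_m)$ is the table of rows of $T$ having values $\delta_1,\ldots,\delta_m$ in the columns labeled $f_{i_1},\ldots,f_{i_m}$. $N(T)$ is the number of rows of $T$. Operations: for $D\subseteq P(T)$, $I(D,T)$ deletes the columns labeled by $D$ and, in each group of rows coinciding on the remaining columns, keeps one row with the minimum decision; $I(P(T),T)=\Lambda$. For $\nu:E_k^{|P(T)|}\to E_2$, $J(\nu,T)$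 replaces the decision of each row $\bar\delta$ by $\nu(\bar\delta)$. $[T]=\{J(\nu,I(D,T)):D\subseteq P(T),\nu:E_k^{|P(T)\setminus D|}\to E_2\}$; $[A]=\bigcup_{T\in A}[T]$; nonempty $A$ is a closed class if $[A]=A$. A $k$-decision tree: finite directed rooted tree with at least two nodes, root and its leaving edges unlabeled, terminal nodes labeled with decisions from $E_2$, other nodes labeled with attributes from $P$ whose leaving edges are labeled with numbers from $E_k$; $P(\Gamma)$ is the set of attributes at nodes. For a complete path $\tau=v_1,d_1,\ldots,v_m,d_m,v_{m+1}$ (root to terminal node), $F(\tau)$ is the empty word if $m=1$, else $f_{i_2}\cdots f_{i_m}$ where $v_j$ is labeled $f_{i_j}$; $T(\tau)=T$ if $m=1$, else $T(f_{i_2},\delta_2)\cdots(f_{i_m},\delta_m)$ with $d_j$ labeled $\delta_j$. For $T\ne\Lambda$, a deterministic decision tree for $T$: exactly one edge leaves the root, edges leaving any other nonterminal node have pairwise different labels, $P(\Gamma)\subseteq P(T)$, every row of $T$ lies in some $T(\tau)$, and for every complete path either $T(\tau)=\Lambda$ or all rows of $T(\tau)$ have the terminal node's decision. For $T\notin\mathcal{M}_k^2\mathcal{C}$, a strongly nondeterministic decision tree for $T$: all terminal nodes labeled $1$, $P(\Gamma)\subseteq P(T)$, every row with decision $1$ lies in some $T(\tau)$, and for every complete path either $T(\tau)=\Lambda$ or all rows of $T(\tau)$ have decision $1$. Let $B$ be the set of finite words over $P$ (with empty word $\lambda$). A complexity measure is $\psi:B\to\omega$ with $\psi(\alpha)=0$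 iff $\alpha=\lambda$, invariant under permutation of letters, $\psi(\alpha_1)\le\psi(\alpha_1\alpha_2)\le\psi(\alpha_1)+\psi(\alpha_2)$; bounded if $\psi(\alpha)\ge|\alpha|$. $\psi(\Gamma)=\max_\tau\psi(F(\tau))$ over complete paths. Parameters ($0$ on $\Lambda$); for $T\ne\Lambda$: $\psi^d(T)$ is the minimum of $\psi(\Gamma)$ over deterministic decision trees for $T$; $\psi^s(T)=0$ if $T\in\mathcal{M}_k^2\mathcal{C}$ and otherwise the minimum of $\psi(\Gamma)$ over strongly nondeterministic decision trees; $V_\psi(T)=\max\{\psi(f_i):f_i\in P(T)\}$; for a row $\bar\delta$, $S(T,\bar\delta)$ is the minimum cardinality of $D\subseteq P(T)$ such that on the columns labeled by $D$ the row $\bar\delta$ differs from all other rows of $T$, and $S(T)=\max_{\bar\delta}S(T,\bar\delta)$. Partial functions: $F_{\psi,A}(n)$ is undefined if $\{\psi^d(T):T\in A,\psi^s(T)\le n\}$ is infinite, and otherwise equals its maximum. $A_\psi(n)=\{T\in A:V_\psi(T)\le n\}$; $S_{\psi,A}(n)$ is undefined if $\{S(T):T\in A_\psi(n)\}$ is infinite and otherwise equals its maximum; $N_{\psi,A}(n)$ is undefined if $\{N(T):T\in A_\psi(n)\}$ is infinite and otherwise equals its maximum. (In the statement, inequalities involving $S_{\psi,A}(n)$, $N_{\psi,A}(n)$ require these values to be defined.) *)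

(* Defs.v *)
From HB Require Import structures.
From mathcomp Require Import all_boot all_order all_algebra finmap.
From mathcomp Require Import boolp classical_sets cardinality reals exp.

Set Implicit Arguments.
Unset Strict Implicit.
Unset Printing Implicit Defensive.

Local Open Scope fset_scope.
Local Open Scope fmap_scope.
Local Open Scope classical_set_scope.
Local Open Scope nat_scope.

(* The attribute f_i is represented by i : nat, the decisions 0 and 1 by false
   and true, a row by the sequence of its values in the order of the columns. *)

Section Tables.
Variable k : nat.

(* All tables without rows are one table Lambda, represented by ([::], [fmap]);
   any other table has at least one column. Rows with their decisions form a
   finite map, so they are pairwise different and unordered. *)
Definition table_ok (t : seq nat * {fmap seq 'I_k -> bool}) : bool :=
  [&& uniq t.1, all (fun r => size r == size t.1) (domf t.2)
    & nilp t.1 == (domf t.2 == fset0)].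

Record table := Table { tval :> seq nat * {fmap seq 'I_k -> bool};
                        _ : table_ok tval }.

HB.instance Definition _ := [isSub for tval].
HB.instance Definition _ := [Choice of table by <:].

Fact Lambda_ok : table_ok ([::], [fmap]).
Proof. by rewrite /table_ok [domf _]domf0 /= eqxx. Qed.

Definition Lambda : table := Table Lambda_ok.

Definition cols (T : table) : seq nat := (tval T).1.
Definition rows (T : table) : {fmap seq 'I_k -> bool} := (tval T).2.

Definition attrs (T : table) : {fset nat} := [fset f in cols T].

Definition value (T : table) (r : seq 'I_k) (f : nat) : option 'I_k :=
  onth r (index f (cols T)).

(* Used only on distinct columns and on rows of the right length; then it yields
   Lambda exactly when there are no columns or no rows, see the lemmas val_*. *)
Definition mk_table (cs : seq nat) (rs : {fmap seq 'I_k -> bool}) : table :=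
  insubd Lambda (cs, rs).

Definition subtable (T : table) (w : seq (nat * 'I_k)) : table :=
  mk_table (cols T)
    (filterf (rows T) (fun r => all (fun fd => value T r fd.1 == Some fd.2) w)).

Definition proj (D : {fset nat}) (T : table) (r : seq 'I_k) : seq 'I_k :=
  mask [seq f \notin D | f <- cols T] r.

(* The minimum decision of a group is 1 iff all its decisions are 1. *)
Definition del_rows (D : {fset nat}) (T : table) : {fmap seq 'I_k -> bool} :=
  [fmap s : [fset proj D T r | r in domf (rows T)] =>
     [forall r : domf (rows T), (proj D T (val r) == val s) ==> rows T r]].

Definition I_op (D : {fset nat}) (T : table) : table :=
  mk_table [seq f <- cols T | f \notin D] (del_rows D T).

(* Only the values of nu on E_k^|P(T)| matter. *)
Definition J_op (nu : seq 'I_k -> bool) (T : table) : table :=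
  mk_table (cols T) [fmap r : domf (rows T) => nu (val r)].

Definition closure1 (T : table) : set table :=
  [set T' | exists (D : {fset nat}) (nu : seq 'I_k -> bool),
      (D `<=` attrs T)%fset /\ T' = J_op nu (I_op D T)].

Definition class_closure (A : set table) : set table := \bigcup_(T in A) closure1 T.

Definition closed_class (A : set table) : Prop := A !=set0 /\ class_closure A = A.

Definition constant_table (T : table) : bool :=
  [forall r : domf (rows T), [forall s : domf (rows T), rows T r == rows T s]].

Lemma table_size (T : table) (r : seq 'I_k) :
  r \in rows T -> size r = size (cols T).
Proof.
by case: T => -[cs rs] p /=; case/and3P: (p) => _ /allP h _ /h /eqP.
Qed.

Lemma table_uniq (T : table) : uniq (cols T).
Proof. by case: T => -[cs rs] p; case/and3P: (p). Qed.

Lemma table_nil (T : table) : (nilp (cols T)) = (domf (rows T) == fset0).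
Proof. by case: T => -[cs rs] p; case/and3P: (p) => _ _ /eqP. Qed.

Lemma table_Lambda (T : table) : domf (rows T) = fset0 -> T = Lambda.
Proof.
move=> T0; apply: val_inj; move: (table_nil T); rewrite T0 eqxx => /nilP.
have := fmap_nil T0; rewrite /rows /cols /=.
by case: T T0 => -[cs rs] /= _ _ -> ->.
Qed.

Lemma val_mk_table cs rs : uniq cs ->
  all (fun r => size r == size cs) (domf rs) ->
  tval (mk_table cs rs) =
    if nilp cs || (domf rs == fset0) then tval Lambda else (cs, rs).
Proof.
move=> u s; rewrite -[tval _]/(val (mk_table cs rs)) val_insubd.
rewrite /table_ok /= u s /=.
case c: (nilp cs); case d: (domf rs == fset0) => //=.
by rewrite (nilP c) (fmap_nil (eqP d)).
Qed.

Lemma val_subtable T w (rs := filterf (rows T)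
    (fun r => all (fun fd => value T r fd.1 == Some fd.2) w)) :
  tval (subtable T w) =
    if domf rs == fset0 then tval Lambda else (cols T, rs).
Proof.
rewrite val_mk_table ?table_uniq //; last first.
  apply/allP => r; rewrite mem_filterf => /andP[/table_size -> _].
  exact: eqxx.
rewrite table_nil; case: eqP => // T0; rewrite orTb.
suff -> : domf rs = fset0 by rewrite eqxx.
apply/fsetP => r; rewrite [RHS]inE; apply/negP; rewrite mem_filterf.
by case/andP => rT _; have : r \in domf (rows T) by []; rewrite T0 inE.
Qed.

Lemma val_J_op nu T :
  tval (J_op nu T) = (cols T, [fmap r : domf (rows T) => nu (val r)]).
Proof.
rewrite val_mk_table ?table_uniq //=; last by apply/allP => r /table_size ->.
rewrite table_nil orbb; case: eqP => // T0.
have -> : [fmap r : domf (rows T) => nu (val r)] = [fmap] by apply: fmap_nil.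
by move: (table_nil T); rewrite T0 eqxx => /nilP ->.
Qed.

Lemma val_I_op D T : (D `<=` attrs T)%fset ->
  tval (I_op D T) = if D == attrs T then tval Lambda else
    ([seq f <- cols T | f \notin D], del_rows D T).
Proof.
move=> DT; rewrite val_mk_table ?filter_uniq ?table_uniq //; last first.
  apply/allP => _ /imfsetP[r /= rT ->]; rewrite /proj size_mask.
    by rewrite size_filter count_map; apply/eqP/eq_count.
  by rewrite size_map (table_size rT).
have -> : nilp [seq f <- cols T | f \notin D] = (D == attrs T).
  rewrite /nilp size_filter eqn0Ngt -has_count; apply/hasPn/eqP => [h|-> f fT].
    apply/eqP; rewrite eqEfsubset DT; apply/fsubsetP => f.
    by rewrite inE /= => /h; rewrite negbK.
  by rewrite negbK inE.
case: eqP => //= /eqP DnT.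
case: eqP => // /eqP; rewrite -[_ == _]negbK; case/negP; apply/fset0Pn.
have /fset0Pn[r rT] : domf (rows T) != fset0.
  rewrite -table_nil; apply: contra DnT => /nilP T0.
  rewrite eqEfsubset DT; apply/fsubsetP => f.
  by rewrite inE /= T0.
by exists (proj D T r); apply/imfsetP; exists r.
Qed.

End Tables.

Arguments Lambda {k}.

Section Trees.
Variable k : nat.

Inductive node : Type :=
  | Leaf of bool
  | Work of nat & seq ('I_k * node).

(* A tree is given by the subtrees at the ends of the edges leaving its root. *)
Definition tree := seq node.

Fixpoint node_ok (v : node) : bool :=
  match v with
  | Leaf _ => true
  | Work _ es => ~~ nilp es && all (fun e => node_ok e.2) es
  end.

Definition tree_ok (G : tree) : bool := ~~ nilp G && all node_ok G.

Fixpoint node_attrs (v : node) : seq nat :=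
  match v with
  | Leaf _ => [::]
  | Work f es => f :: flatten [seq node_attrs e.2 | e <- es]
  end.

Definition tree_attrs (G : tree) : {fset nat} :=
  [fset f in flatten (map node_attrs G)].

(* A complete path is recorded by the pairs (f_{i_j}, delta_j) along it and by
   the decision of its terminal node. *)
Fixpoint node_paths (v : node) : seq (seq (nat * 'I_k) * bool) :=
  match v with
  | Leaf d => [:: ([::], d)]
  | Work f es =>
      flatten [seq [seq ((f, e.1) :: p.1, p.2) | p <- node_paths e.2] | e <- es]
  end.

Definition paths (G : tree) : seq (seq (nat * 'I_k) * bool) :=
  flatten (map node_paths G).

Fixpoint node_det (v : node) : bool :=
  match v with
  | Leaf _ => true
  | Work _ es => uniq [seq e.1 | e <- es] && all (fun e => node_det e.2) es
  end.

Definition det_tree (T : table k) (G : tree) : Prop :=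
  [/\ tree_ok G,
      size G = 1 /\ all node_det G,
      (tree_attrs G `<=` attrs T)%fset,
      (forall r, r \in rows T ->
         exists2 p, p \in paths G & r \in rows (subtable T p.1)) &
      forall p, p \in paths G ->
        subtable T p.1 = Lambda \/
        forall r, r \in rows (subtable T p.1) ->
          (rows (subtable T p.1)).[? r] = Some p.2].

Definition snd_tree (T : table k) (G : tree) : Prop :=
  [/\ tree_ok G,
      (forall p, p \in paths G -> p.2 = true),
      (tree_attrs G `<=` attrs T)%fset,
      (forall r, (rows T).[? r] = Some true ->
         exists2 p, p \in paths G & r \in rows (subtable T p.1)) &
      forall p, p \in paths G ->
        subtable T p.1 = Lambda \/
        forall r, r \in rows (subtable T p.1) ->
          (rows (subtable T p.1)).[? r] = Some true].

Definition tree_measure (psi : seq nat -> nat) (G : tree) : nat :=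
  \max_(p <- paths G) psi (unzip1 p.1).

End Trees.

Definition complexity_measure (psi : seq nat -> nat) : Prop :=
  [/\ forall w, psi w = 0 <-> w = [::],
      forall w1 w2, perm_eq w1 w2 -> psi w1 = psi w2 &
      forall w1 w2, psi w1 <= psi (w1 ++ w2) <= psi w1 + psi w2].

Definition bounded_measure (psi : seq nat -> nat) : Prop :=
  forall w, size w <= psi w.

(* 0 for empty X; the sets minimized below are nonempty whenever k > 0. *)
Definition nat_min (X : set nat) : nat :=
  xget 0 [set m | X m /\ forall j, X j -> m <= j].

(* None stands for "undefined". *)
Definition nat_max (X : set nat) : option nat :=
  if `[< finite_set X >] then Some (\max_(i <- fset_set X) i) else None.

Section TableFunctions.
Variables (k : nat) (psi : seq nat -> nat).
Implicit Types (T : table k) (A : set (table k)).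

Definition psi_d T : nat :=
  if T == Lambda then 0
  else nat_min [set tree_measure psi G | G in [set G | det_tree T G]].

Definition psi_s T : nat :=
  if constant_table T then 0
  else nat_min [set tree_measure psi G | G in [set G | snd_tree T G]].

Definition V_ T : nat := \max_(f <- cols T) psi [:: f].

Definition S_row T (r : seq 'I_k) : nat :=
  nat_min [set #|` D| | D in [set D : {fset nat} | (D `<=` attrs T)%fset /\
    forall s, s \in rows T -> s != r ->
      exists2 f, f \in D & value T r f != value T s f]].

Definition S_ T : nat := \max_(r <- domf (rows T)) S_row T r.

Definition N_ T : nat := #|` domf (rows T)|.

Definition F_class A (n : nat) : option nat :=
  nat_max [set psi_d T | T in [set T | A T /\ psi_s T <= n]].

Definition A_below A (n : nat) : set (table k) := [set T | A T /\ V_ T <= n].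

Definition S_class A (n : nat) : option nat :=
  nat_max [set S_ T | T in A_below A n].

Definition N_class A (n : nat) : option nat :=
  nat_max [set N_ T | T in A_below A n].

End TableFunctions.

Definition defined_le (R : realType) (o : option nat) (x : R) : Prop :=
  exists2 v, o = Some v & (v%:R <= x)%R.

(* Main.v *)
(* For a table T with V(T) <= n and a minimal set D of attributes distinguishing
   a row r from the others, delete the columns outside D and give decision 0 to r
   alone: a strongly nondeterministic tree needs one query per path, whereas a
   deterministic tree queries all of D on the path of r; hence S(n) <= F(n).
   Every row then has a certificate of at most s = F(n) attributes, so every
   0-1 colouring of the rows of T has strongly nondeterministic complexity at
   most n s, hence deterministic complexity at most h = F(n s). Keeping at most
   N = N(T) columns which separate the rows and counting trees of depth h gives
   N <= log N (k+1)^h up to rounding.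
   Conversely, if S <= s and N <= 2^m at n, keep only the attributes of an optimal
   strongly nondeterministic tree. By S <= s every tuple, whether or not it is a
   row, is isolated from all rows but at most one by s + 1 attributes, and the
   halving strategy gives a deterministic tree of depth (s + 1) m. *)
Require Import Defs.
From HB Require Import structures.
From mathcomp Require Import all_boot all_order all_algebra finmap.
From mathcomp Require Import zify.
From mathcomp Require Import boolp classical_sets cardinality reals exp.
Import Order.TTheory GRing.Theory Num.Theory.

Set Implicit Arguments.
Unset Strict Implicit.

Local Open Scope fset_scope.
Local Open Scope fmap_scope.
Local Open Scope nat_scope.

(** * Minima and maxima of sets of natural numbers *)

Lemma nat_min_le (X : set nat) (m : nat) : X m -> nat_min X <= m.
Proof.
move=> Xm; rewrite /nat_min; case: xgetP => [x _ [_ /(_ m Xm)] //|_].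
exact: leq0n.
Qed.

Lemma nat_min_mem (X : set nat) (m : nat) : X m -> X (nat_min X).
Proof.
move=> Xm; rewrite /nat_min; case: xgetP => [x _ [] //|noX].
have exX : exists n, `[< X n >] by exists m; apply/asboolP.
case: (ex_minnP exX) => n /asboolP Xn n_min.
case: (noX n); split=> // j Xj; apply: n_min; exact/asboolP.
Qed.

Lemma nat_max_ge (X : set nat) (v x : nat) : nat_max X = Some v -> X x -> x <= v.
Proof.
rewrite /nat_max; case: asboolP => // finX [<-] Xx.
by apply: (leq_bigmax_seq (F := id)) => //; rewrite in_fset_set // inE.
Qed.

Lemma nat_max_le (X : set nat) (v b : nat) :
  nat_max X = Some v -> (forall x, X x -> x <= b) -> v <= b.
Proof.
rewrite /nat_max; case: asboolP => // finX [<-] Xb.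
by apply/bigmax_leqP_seq => x; rewrite in_fset_set // inE => /Xb.
Qed.

Lemma nat_max_def (X : set nat) (b : nat) :
  (forall x, X x -> x <= b) -> exists2 v, nat_max X = Some v & v <= b.
Proof.
move=> Xb; case mX: (nat_max X) => [v|]; first by exists v => //; exact: nat_max_le mX Xb.
move: mX; rewrite /nat_max; case: asboolP => // -[].
by apply: (@sub_finite_set _ _ `I_b.+1) => [x /Xb|]; [|exact: finite_II].
Qed.

(** * Complexity measures of words *)

Section Measure.
Variable psi : seq nat -> nat.
Hypothesis hpsi : complexity_measure psi.

Lemma psi1_le (f : nat) (w : seq nat) : f \in w -> psi [:: f] <= psi w.
Proof.
case: hpsi => _ perm mono fw; rewrite (perm _ _ (perm_to_rem fw)).
by have /andP[] := mono [:: f] (rem f w).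
Qed.

Lemma psi_le_size (b : nat) (w : seq nat) :
  (forall f, f \in w -> psi [:: f] <= b) -> psi w <= b * size w.
Proof.
case: hpsi => psi0 _ mono; elim: w => [|f w IH] wb.
  by have -> : psi [::] = 0 by apply/psi0.
have /andP[_] := mono [:: f] w; move/leq_trans; apply.
rewrite /= mulnS leq_add ?wb ?mem_head // IH // => g gw.
by apply: wb; rewrite inE gw orbT.
Qed.

End Measure.

(** * Rows, subtables and restriction to a set of columns *)

Section Tables.
Variable k : nat.
Implicit Types (T : table k) (r : seq 'I_k) (w : seq (nat * 'I_k)) (E : {fset nat}).

Definition dec T r : bool := odflt false (rows T).[? r].

Definition sat T r w : bool := all (fun fd => value T r fd.1 == Some fd.2) w.

Lemma fnd_dec T r : r \in rows T -> (rows T).[? r] = Some (dec T r).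
Proof. by rewrite /dec; case: fndP. Qed.

Lemma attrsE T f : (f \in attrs T) = (f \in cols T).
Proof. by rewrite inE. Qed.

Lemma mem_subtable T w r : (r \in rows (subtable T w)) = (r \in rows T) && sat T r w.
Proof.
rewrite -(mem_filterf (rows T) (fun r => sat T r w)).
rewrite {1}/rows val_subtable -/(sat T _ w).
by case: eqP => //= ->.
Qed.

Lemma fnd_subtable T w r : r \in rows (subtable T w) ->
  (rows (subtable T w)).[? r] = Some (dec T r).
Proof.
move=> rw; have rT : r \in rows T by move: rw; rewrite mem_subtable => /andP[].
have rs : sat T r w by move: rw; rewrite mem_subtable => /andP[].
move: rw; rewrite /rows val_subtable; case: eqP => // _ _.
by rewrite fnd_filterf -/(sat T r w) rs; apply: fnd_dec.
Qed.

Lemma subtable_neq_Lambda T w r : r \in rows (subtable T w) -> subtable T w <> Lambda.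
Proof. by move=> rw E; move: rw; rewrite E. Qed.

Lemma table_neq_Lambda T : T <> Lambda -> exists r, r \in rows T.
Proof.
move=> TL; have /fset0Pn[r rT] : domf (rows T) != fset0.
  by apply/eqP => /table_Lambda.
by exists r.
Qed.

Lemma row_neq_Lambda T r : r \in rows T -> T <> Lambda.
Proof. by move=> rT TL; rewrite TL in rT. Qed.

Lemma value_cols T r f : r \in rows T -> f \in cols T -> exists a, value T r f = Some a.
Proof.
move=> rT fT; rewrite /value.
have := onthTE r (index f (cols T)).
by rewrite (table_size rT) index_mem fT; case: onth => // a _; exists a.
Qed.

Lemma value_notin T r f : r \in rows T -> f \notin cols T -> value T r f = None.
Proof.
by move=> rT fT; apply: onth_default; rewrite (table_size rT) leqNgt index_mem.
Qed.

Lemma value_inj T r s : r \in rows T -> s \in rows T ->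
  {in cols T, value T r =1 value T s} -> r = s.
Proof.
move=> rT sT rs; apply: (@eq_from_onth _ r s) => i.
have [lt_i|ge_i] := ltnP i (size (cols T)); last first.
  by rewrite !onth_default ?(table_size rT) ?(table_size sT).
have := rs (nth 0 (cols T) i) (mem_nth _ lt_i).
by rewrite /value index_uniq // table_uniq.
Qed.

Lemma constant_tableP T : reflect {in rows T &, forall r s, dec T r = dec T s} (constant_table T).
Proof.
apply: (iffP forallP) => [cT r s rT sT|cT [r rT]].
  move/forallP/(_ [` sT]): (cT [` rT]) => /eqP.
  by rewrite /dec (in_fnd rT) (in_fnd sT).
apply/forallP => -[s sT]; apply/eqP.
by have := cT r s rT sT; rewrite /dec (in_fnd rT) (in_fnd sT).
Qed.

(** An element of [closure1 T]. The decisions produced by [I_op] are overwritten by [nu], so only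
    the projected rows matter. *)
Definition restr T E (nu : seq 'I_k -> bool) : table k :=
  J_op nu (I_op (attrs T `\` E) T).

Definition keep T E r : seq 'I_k := proj (attrs T `\` E) T r.

Section Restriction.
Variables (T : table k) (E : {fset nat}) (nu : seq 'I_k -> bool).
Hypotheses (ET : E `<=` attrs T) (E0 : E != fset0).

(** Deleting all columns yields [Lambda] instead of a projection; a nonempty [E] excludes this case
    of [val_I_op]. *)
Lemma restr_neq : (attrs T `\` E == attrs T) = false.
Proof.
apply/negP => /eqP eqE; case/fset0Pn: E0 => f fE.
have := fsubsetP ET f fE; rewrite -eqE inE fE //.
Qed.

Lemma mem_keep f : f \in cols T -> (f \notin attrs T `\` E) = (f \in E).
Proof. by move=> fT; rewrite in_fsetD attrsE fT andbT negbK. Qed.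

Lemma cols_restr : cols (restr T E nu) = [seq f <- cols T | f \in E].
Proof.
rewrite /restr {1}/cols val_J_op /= /cols val_I_op ?fsubsetDl //.
by rewrite restr_neq /=; apply: eq_in_filter => f /mem_keep.
Qed.

Lemma mem_cols_restr f : (f \in cols (restr T E nu)) = (f \in E).
Proof.
rewrite cols_restr mem_filter; apply: andb_idr => /(fsubsetP ET).
by rewrite attrsE.
Qed.

Lemma attrs_restr : attrs (restr T E nu) = E.
Proof. by apply/fsetP => f; rewrite attrsE mem_cols_restr. Qed.

Lemma domf_restr : domf (rows (restr T E nu)) = [fset keep T E r | r in domf (rows T)].
Proof.
rewrite /restr {1}/rows val_J_op /= {1}/rows val_I_op ?fsubsetDl //.
by rewrite restr_neq.
Qed.

Lemma keep_restr r : r \in rows T -> keep T E r \in rows (restr T E nu).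
Proof.
move=> rT; have : keep T E r \in domf (rows (restr T E nu)); last by [].
by rewrite domf_restr; apply: in_imfset.
Qed.

Lemma restr_keep t : t \in rows (restr T E nu) -> exists2 r, r \in rows T & t = keep T E r.
Proof.
move=> tT; have : t \in domf (rows (restr T E nu)) by [].
by rewrite domf_restr => /imfsetP[r rT ->]; exists r.
Qed.

Lemma dec_restr t : t \in rows (restr T E nu) -> dec (restr T E nu) t = nu t.
Proof.
have rowsE : rows (restr T E nu) =
  [fmap r : domf (rows (I_op (attrs T `\` E) T)) => nu (val r)].
  by rewrite /restr {1}/rows val_J_op.
by rewrite /dec rowsE => tT; rewrite (in_fnd tT) ffunE.
Qed.

(** Filtering the columns and masking the row drop the same positions, so the index of a kept
    attribute still points to its value. *)
Lemma value_restr r f : r \in rows T -> f \in E ->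
  value (restr T E nu) (keep T E r) f = value T r f.
Proof.
move=> rT fE; rewrite /value cols_restr /keep /proj.
have -> : [seq g \notin attrs T `\` E | g <- cols T] = [seq g \in E | g <- cols T].
  by apply/eq_in_map => g /mem_keep.
have fT : f \in cols T by rewrite -attrsE (fsubsetP ET).
move: (table_size rT) fT; clear rT; elim: (cols T) r => [|g cs IH] [|a r] //= [szr].
rewrite inE; case: eqVneq => [<- _|fg /= fcs].
  by rewrite fE /= eqxx.
case: ifP => gE /=; last exact: IH.
by rewrite eq_sym (negPf fg) /=; exact: IH.
Qed.

End Restriction.

End Tables.

(** * Decision trees, their complete paths and their attributes *)

HB.instance Definition _ (k : nat) := gen_eqMixin (node k).

Section Trees.
Variable k : nat.
Implicit Types (T : table k) (r : seq 'I_k) (w : seq (nat * 'I_k)) (v : node k)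
  (es : seq ('I_k * node k)) (G : tree k).

(** Induction has to reach children nested in a list of pairs; the inner fixpoint walks through that
    list. *)
Fixpoint node_nested_ind (P : node k -> Prop) (Pleaf : forall d, P (Leaf k d))
    (Pwork : forall f es, (forall e, e \in es -> P e.2) -> P (Work f es)) v : P v :=
  match v with
  | Leaf d => Pleaf d
  | Work f es => Pwork f es
      ((fix children (es : seq ('I_k * node k)) : forall e, e \in es -> P e.2 :=
        match es with
        | [::] => fun e (h : e \in [::]) => False_ind _ (notF h)
        | e0 :: es' => fun e h =>
            match orP (eq_ind _ is_true h _ (in_cons e0 es' e)) with
            | or_introl e_e0 =>
                eq_ind _ (fun x => P x.2) (node_nested_ind Pleaf Pwork e0.2) _ (esym (eqP e_e0))
            | or_intror h' => children es' e h'
            end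
        end) es)
  end.

Lemma work_pathP f es (p : seq (nat * 'I_k) * bool) :
  reflect (exists e q, [/\ e \in es, q \in node_paths e.2 & p = ((f, e.1) :: q.1, q.2)])
    (p \in node_paths (Work f es)).
Proof.
apply: (iffP flatten_mapP) => [[e ees /mapP[q qe ->]]|[e [q [ees qe ->]]]].
  by exists e, q.
by exists e => //; apply/mapP; exists q.
Qed.

Lemma path_attrs v p f : p \in node_paths v -> f \in unzip1 p.1 -> f \in node_attrs v.
Proof.
elim/node_nested_ind: v p => [d|g es IH] p; first by rewrite inE => /eqP->.
move=> /work_pathP[e [q [ees qe ->]]]; rewrite /= !inE => /orP[->//|fq].
by apply/orP; right; apply/flatten_mapP; exists e => //; apply: IH fq.
Qed.

Lemma node_has_path v : node_ok v -> exists p, p \in node_paths v.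
Proof.
elim/node_nested_ind: v => [d _|g es IH]; first by exists ([::], d); rewrite inE.
case/andP; case: es IH => // e es IH _ /allP ok.
have [p pe] := IH e (mem_head _ _) (ok e (mem_head _ _)).
by exists ((g, e.1) :: p.1, p.2); apply/work_pathP; exists e, p; rewrite mem_head.
Qed.

(** [node_ok] gives every working node a leaving edge, so each node lies on a complete path. *)
Lemma attrs_path v f : node_ok v -> f \in node_attrs v ->
  exists2 p, p \in node_paths v & f \in unzip1 p.1.
Proof.
elim/node_nested_ind: v => [//|g es IH] okv.
have /= /andP[_ /allP ok] := okv.
rewrite inE => /orP[/eqP->|/flatten_mapP[e ees fe]].
  have [p pv] := node_has_path okv; exists p => //.
  by case/work_pathP: pv => e [q [_ _ ->]]; rewrite mem_head.
have [q qe fq] := IH e ees (ok e ees) fe.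
exists ((g, e.1) :: q.1, q.2); first by apply/work_pathP; exists e, q.
by rewrite inE fq orbT.
Qed.

Lemma pathsP G p : reflect (exists2 v, v \in G & p \in node_paths v) (p \in paths G).
Proof. exact: flatten_mapP. Qed.

Lemma paths1 v : paths [:: v] = node_paths v.
Proof. by rewrite /paths /= cats0. Qed.

Lemma tree_attrsE G f : (f \in tree_attrs G) = (f \in flatten (map (@node_attrs k) G)).
Proof. by rewrite inE. Qed.

Lemma paths_attrs G p f : p \in paths G -> f \in unzip1 p.1 -> f \in tree_attrs G.
Proof.
case/pathsP => v vG pv /(path_attrs pv) fv.
by rewrite inE; apply/flatten_mapP; exists v.
Qed.

Lemma attrs_paths G f : tree_ok G -> f \in tree_attrs G ->
  exists2 p, p \in paths G & f \in unzip1 p.1.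
Proof.
case/andP=> _ /allP ok; rewrite inE /= => /flatten_mapP[v vG fv].
have [p pv fp] := attrs_path (ok v vG) fv.
by exists p => //; apply/pathsP; exists v.
Qed.

Section Measure.
Variable psi : seq nat -> nat.
Hypothesis hpsi : complexity_measure psi.

Lemma path_measure G p : p \in paths G -> psi (unzip1 p.1) <= tree_measure psi G.
Proof. by move=> pG; apply: (leq_bigmax_seq (F := fun p => psi (unzip1 p.1))). Qed.

Lemma psi_cols T f : f \in cols T -> psi [:: f] <= V_ psi T.
Proof. by move=> fT; apply: (leq_bigmax_seq (F := fun f => psi [:: f])). Qed.

Lemma V_le T b : (forall f, f \in cols T -> psi [:: f] <= b) -> V_ psi T <= b.
Proof. by move=> Tb; apply/bigmax_leqP_seq => f fT _; apply: Tb. Qed.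

Lemma tree_measure_le T G d : tree_attrs G `<=` attrs T ->
  (forall p, p \in paths G -> size p.1 <= d) -> tree_measure psi G <= V_ psi T * d.
Proof.
move=> GT Gd; apply/bigmax_leqP_seq => p pG _.
apply: (@leq_trans (V_ psi T * size (unzip1 p.1))).
  apply: psi_le_size => // f fp; apply: psi_cols.
  by rewrite -attrsE (fsubsetP GT) // (paths_attrs pG).
by rewrite leq_mul2l size_map Gd ?orbT.
Qed.

End Measure.

(** * Deterministic trees by the halving strategy *)

Section Halving.
Variables (T : table k) (c : nat).
Hypothesis k_gt0 : 0 < k.

Definition agree (delta : nat -> 'I_k) (D : seq nat) r : bool :=
  all (fun f => value T r f == Some (delta f)) D.

(** The predicate [Q] selects the rows compatible with the answers given above the node [v]. *)
Definition decides v (Q : pred (seq 'I_k)) (d : nat) : Prop :=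
  [/\ node_ok v, node_det v, {subset node_attrs v <= cols T},
    forall p, p \in node_paths v -> size p.1 <= d /\
      forall r, r \in rows T -> Q r -> sat T r p.1 -> dec T r = p.2 &
    forall r, r \in rows T -> Q r -> exists2 p, p \in node_paths v & sat T r p.1].

Lemma decides_sub v (Q Q' : pred (seq 'I_k)) d d' :
  (forall r, Q' r -> Q r) -> d <= d' -> decides v Q d -> decides v Q' d'.
Proof.
move=> QQ' dd' [? ? ? h1 h2]; split=> // [p /h1[pd hp]|r rT /QQ' rQ].
  by split=> [|r rT /QQ' rQ]; [exact: leq_trans dd'|exact: hp].
exact: h2.
Qed.

Lemma decides_leaf (Q : pred (seq 'I_k)) d :
  (forall r s, r \in rows T -> s \in rows T -> Q r -> Q s -> dec T r = dec T s) ->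
  exists v, decides v Q d.
Proof.
move=> hQ; pose X := enum_fset (domf (rows T)).
have [/hasP[s sT sQ]|noQ] := boolP (has Q X).
  exists (Leaf k (dec T s)); split=> // [p|r rT rQ]; last by exists ([::], dec T s); rewrite ?inE.
  by rewrite inE => /eqP-> /=; split=> // r rT rQ _; apply: hQ.
exists (Leaf k false); split=> // [p|r rT rQ].
  rewrite inE => /eqP-> /=; split=> // r rT rQ _.
  by case/hasP: noQ; exists r.
by case/hasP: noQ; exists r.
Qed.

Lemma decides_work (Q : pred (seq 'I_k)) f d : f \in cols T ->
  (forall a, exists v, decides v (fun r => Q r && (value T r f == Some a)) d) ->
  exists v, decides v Q d.+1.
Proof.
move=> fT /choice[g hg]; exists (Work f [seq (a, g a) | a <- enum 'I_k]); split.
- rewrite /= /nilp size_map size_enum_ord -lt0n k_gt0 /=.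
  by apply/allP => _ /mapP[a _ ->] /=; case: (hg a).
- rewrite /= -map_comp map_id enum_uniq /=.
  by apply/allP => _ /mapP[a _ ->] /=; case: (hg a).
- move=> h; rewrite inE => /orP[/eqP->//|/flatten_mapP[_ /mapP[a _ ->] /= ha]].
  by case: (hg a) => _ _ /(_ h ha).
- move=> _ /work_pathP[_ [q [/mapP[a _ ->] /= qa ->]]] /=.
  have [_ _ _ /(_ q qa)[qd hq] _] := hg a; split=> // r rT rQ /andP[ra rq].
  by apply: hq; rewrite ?rQ.
- move=> r rT rQ; have [a ra] := value_cols rT fT.
  have [_ _ _ _ /(_ r rT)] := hg a; rewrite rQ ra eqxx => /(_ isT)[q qa rq].
  exists ((f, a) :: q.1, q.2); last by rewrite /sat /= ra eqxx.
  by apply/work_pathP; exists (a, g a), q; rewrite map_f ?mem_enum.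
Qed.

(** Query [D] in order: agreement with [delta] leads to the next query, the first deviation hands
    over to a tree of depth [d], and agreement on all of [D] leads to a leaf. *)
Lemma decides_seq delta D (Q : pred (seq 'I_k)) d : {subset D <= cols T} ->
  (forall r s, r \in rows T -> s \in rows T -> Q r && agree delta D r ->
     Q s && agree delta D s -> dec T r = dec T s) ->
  (forall f a, f \in D -> a != delta f ->
     exists v, decides v (fun r => Q r && (value T r f == Some a)) d) ->
  exists v, decides v Q (size D + d).
Proof.
elim: D Q => [|f D IH] Q DT hQ hd.
  by apply: decides_leaf => r s rT sT rQ sQ; apply: hQ; rewrite ?rQ ?sQ.
rewrite addSn; apply: (decides_work (f := f)); first exact/DT/mem_head.
move=> a; have [->|ad] := eqVneq a (delta f); last first.
  have [v hv] := hd f a (mem_head _ _) ad.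
  by exists v; apply: decides_sub hv; rewrite ?leq_addl.
apply: IH => [g gD|r s rT sT|g b gD bd]; first by apply: DT; rewrite inE gD orbT.
  by rewrite -!andbA; apply: hQ.
have gfD : g \in f :: D by rewrite inE gD orbT.
have [v hv] := hd g b gfD bd.
by exists v; apply: decides_sub hv => // r /andP[/andP[-> _] ->].
Qed.

Hypothesis certificate : forall delta : nat -> 'I_k, exists D,
  [/\ size D <= c, {subset D <= cols T} &
    forall r s, r \in rows T -> s \in rows T ->
      agree delta D r -> agree delta D s -> dec T r = dec T s].

(* Follow a certificate of the pointwise majority tuple: each deviation from it
   at least halves the number of remaining rows. *)
Lemma decides_halving m (Q : pred (seq 'I_k)) :
  count Q (enum_fset (domf (rows T))) <= 2 ^ m -> exists v, decides v Q (c * m).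
Proof.
set X := enum_fset _; elim: m Q => [|m IH] Q Qm.
  apply: decides_leaf => r s rT sT rQ sQ; have [->//|rs] := eqVneq r s.
  suff : 1 < count Q X by rewrite ltnNge Qm.
  rewrite -size_filter -[2]/(size [:: r; s]); apply: uniq_leq_size.
    by rewrite /= inE rs.
  by move=> t; rewrite !inE mem_filter => /orP[]/eqP->; rewrite ?rQ ?sQ.
pose cnt f a := count (fun r => Q r && (value T r f == Some a)) X.
pose delta f := [arg max_(a > Ordinal k_gt0) cnt f a].
have [D [Dc DT hD]] := certificate delta.
have [|f a fD ad|v hv] := @decides_seq delta D Q (c * m) DT.
- by move=> r s rT sT /andP[_ rD] /andP[_ sD]; apply: hD.
- apply: IH; rewrite -leq_double -!muln2 -expnSr; apply: leq_trans Qm.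
  (* The rows with value [a] and those with the majority value are disjoint, and the former are no
     more numerous, hence at most half of all. *)
  have le_cnt : cnt f a <= cnt f (delta f).
    by rewrite /delta; case: arg_maxnP => // b _; apply.
  rewrite muln2 -addnn; apply: (@leq_trans (cnt f a + cnt f (delta f))).
    by rewrite leq_add2l.
  rewrite /cnt -count_predUI [X in _ + X](eq_count (a2 := pred0)).
    by rewrite count_pred0 addn0; apply: sub_count => r /orP[]/andP[].
  move=> r /=; apply/negP => /andP[/andP[_ /eqP->] /andP[_ /eqP[ad']]].
  by rewrite ad' eqxx in ad.
- exists v; apply: decides_sub hv => //.
  by rewrite mulnS leq_add2r.
Qed.

End Halving.

End Trees.

(** * Upper bounds and optimal trees for the parameters of a table *)

Section Complexity.
Variables (k : nat) (psi : seq nat -> nat).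
Hypothesis hpsi : complexity_measure psi.
Hypothesis k_gt0 : 0 < k.
Implicit Types (T : table k) (r : seq 'I_k) (w : seq (nat * 'I_k)) (G : tree k).

Lemma det_tree_sat T G p r : det_tree T G -> p \in paths G -> r \in rows T ->
  sat T r p.1 -> dec T r = p.2.
Proof.
case=> _ _ _ _ hG pG rT rp.
have rw : r \in rows (subtable T p.1) by rewrite mem_subtable rT rp.
case: (hG p pG) => [/(subtable_neq_Lambda rw)//|/(_ r rw)].
by rewrite fnd_subtable // => -[].
Qed.

Lemma det_tree_cover T G r : det_tree T G -> r \in rows T ->
  exists2 p, p \in paths G & sat T r p.1.
Proof.
case=> _ _ _ cov _ rT; have [p pG] := cov r rT.
by rewrite mem_subtable => /andP[_ ?]; exists p.
Qed.

(** The halving strategy applied at the root, where every row is still possible. *)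
Lemma det_tree_bounded T c m :
  (forall delta : nat -> 'I_k, exists D,
    [/\ size D <= c, {subset D <= cols T} &
      forall r s, r \in rows T -> s \in rows T ->
        agree T delta D r -> agree T delta D s -> dec T r = dec T s]) ->
  N_ T <= 2 ^ m ->
  exists G, det_tree T G /\ forall p, p \in paths G -> size p.1 <= c * m.
Proof.
move=> cert Tm.
have [|v [okv detv attrv hp cov]] := decides_halving k_gt0 cert (m := m) (Q := predT).
  by rewrite count_predT.
exists [:: v]; split; last by move=> p; rewrite paths1 => /hp[].
split=> //.
- by rewrite /tree_ok /= okv.
- by rewrite /= detv.
- apply/fsubsetP => f; rewrite attrsE tree_attrsE => /flatten_mapP[v' v'v].
  by move: v'v; rewrite inE => /eqP->; apply: attrv.
- move=> r rT; have [p pv rp] := cov r rT isT.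
  by exists p; rewrite ?paths1 // mem_subtable rT rp.
- move=> p; rewrite paths1 => /hp[_ hr]; right => r rw; rewrite fnd_subtable //.
  by move: rw; rewrite mem_subtable => /andP[rT rp]; rewrite hr.
Qed.

(** Crude parameters suffice: all columns serve as certificate, and [N_ T < 2 ^ N_ T]. *)
Lemma det_tree_exists T : exists G, det_tree T G.
Proof.
have [|//|G [hG _]] := @det_tree_bounded T (size (cols T)) (N_ T).
- move=> delta; exists (cols T); split=> // r s rT sT /allP hr /allP hs.
  congr dec; apply: (value_inj rT sT) => f fT.
  by rewrite (eqP (hr f fT)) (eqP (hs f fT)).
- exact/ltnW/ltn_expl.
- by exists G.
Qed.

Lemma psi_d_le T G : det_tree T G -> psi_d psi T <= tree_measure psi G.
Proof. by move=> hG; rewrite /psi_d; case: eqP => // _; apply: nat_min_le; exists G. Qed.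

Lemma psi_d_attained T : T <> Lambda ->
  exists2 G, det_tree T G & tree_measure psi G = psi_d psi T.
Proof.
move=> TL; rewrite /psi_d; case: eqP => // _; have [G hG] := det_tree_exists T.
have [|G' hG' <-] := @nat_min_mem
    [set tree_measure psi G | G in [set G | det_tree T G]]%classic (tree_measure psi G).
  by exists G.
by exists G'.
Qed.

Fixpoint chain w : node k :=
  if w is (f, a) :: w' then Work f [:: (a, chain w')] else Leaf k true.

Lemma chain_paths w : node_paths (chain w) = [:: (w, true)].
Proof. by elim: w => // -[f a] w /= ->. Qed.

Lemma chain_attrs w : node_attrs (chain w) = unzip1 w.
Proof. by elim: w => // -[f a] w /= ->; rewrite cats0. Qed.

Lemma chain_ok w : node_ok (chain w).
Proof. by elim: w => // -[f a] w /= ->. Qed.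

(** The tree has one [chain] per row with decision 1, following a certificate of that row. *)
Lemma snd_tree_bounded T c : ~~ constant_table T ->
  (forall r, r \in rows T -> dec T r -> exists w,
    [/\ size w <= c, {subset unzip1 w <= cols T}, sat T r w &
      forall s, s \in rows T -> sat T s w -> dec T s]) ->
  exists2 G, snd_tree T G & tree_measure psi G <= V_ psi T * c.
Proof.
move=> ncT hw; pose good r w := (r \in rows T) && dec T r ->
  [/\ size w <= c, {subset unzip1 w <= cols T}, sat T r w &
      forall s, s \in rows T -> sat T s w -> dec T s].
have /choice[g hg] r : exists w, good r w.
  have [/andP[rT rd]|nr] := boolP ((r \in rows T) && dec T r); last first.
    by exists [::] => h; rewrite h in nr.
  by have [w hrw] := hw r rT rd; exists w.
pose X := [seq r <- enum_fset (domf (rows T)) | dec T r].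
have memX r : (r \in X) = (r \in rows T) && dec T r by rewrite mem_filter andbC.
pose G := [seq chain (g r) | r <- X].
have pG p : reflect (exists2 r, r \in X & p = (g r, true)) (p \in paths G).
  apply: (iffP (pathsP _ _)) => [[_ /mapP[r rX ->]]|[r rX ->]].
    by rewrite chain_paths inE => /eqP->; exists r.
  by exists (chain (g r)); [exact: map_f|rewrite chain_paths inE].
have gr r (rX : r \in X) := hg r (etrans (esym (memX r)) rX).
have GT : tree_attrs G `<=` attrs T.
  apply/fsubsetP => f; rewrite tree_attrsE attrsE => /flatten_mapP[_ /mapP[r rX ->]].
  by rewrite chain_attrs; case: (gr r rX) => _ + _ _; apply.
exists G; last by apply: tree_measure_le => // p /pG[r rX ->]; case: (gr r rX).
split=> //.
- apply/andP; split; last by apply/allP => _ /mapP[r _ ->]; apply: chain_ok.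
  (* A table that is not constant has a row with decision 1, so the root has a leaving edge. *)
  rewrite /nilp size_map size_filter -lt0n -has_count; apply: contraR ncT => noX.
  apply/constant_tableP => r s rT sT; move/hasPn: noX => noX.
  by rewrite (negbTE (noX r rT)) (negbTE (noX s sT)).
- by move=> p /pG[r _ ->].
- move=> r rd; have rT : r \in rows T by move: rd; case: fndP.
  have rX : r \in X by rewrite memX rT /dec rd.
  exists (g r, true); first by apply/pG; exists r.
  by rewrite mem_subtable rT /=; case: (gr r rX).
- move=> p /pG[r rX ->]; right => s sw; rewrite fnd_subtable //.
  move: sw; rewrite mem_subtable => /andP[sT sg].
  by case: (gr r rX) => _ _ _ /(_ s sT sg) ->.
Qed.

Lemma psi_s_le T c :
  (forall r, r \in rows T -> dec T r -> exists w,
    [/\ size w <= c, {subset unzip1 w <= cols T}, sat T r w &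
      forall s, s \in rows T -> sat T s w -> dec T s]) ->
  psi_s psi T <= V_ psi T * c.
Proof.
move=> hw; rewrite /psi_s; case: (boolP (constant_table T)) => // ncT.
have [G hG hm] := snd_tree_bounded ncT hw.
by apply: leq_trans hm; apply: nat_min_le; exists G.
Qed.

(** The default [Ordinal k_gt0] never occurs when [r] is a row and [D] consists of columns of
    [T]. *)
Definition row_word T r (D : {fset nat}) : seq (nat * 'I_k) :=
  [seq (f, odflt (Ordinal k_gt0) (value T r f)) | f <- enum_fset D].

Lemma row_word_attrs T r D : unzip1 (row_word T r D) = enum_fset D.
Proof. by rewrite /unzip1 -map_comp map_id. Qed.

Lemma sat_row_word T r s D : r \in rows T -> D `<=` attrs T ->
  sat T s (row_word T r D) = all (fun f => value T s f == value T r f) (enum_fset D).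
Proof.
move=> rT DT; rewrite /sat all_map; apply: eq_in_all => f fD /=.
have fT : f \in cols T by rewrite -attrsE (fsubsetP DT).
by have [a ->] := value_cols rT fT.
Qed.

(** Reading a whole row certifies its decision, so the minimum is taken over a nonempty set. *)
Lemma psi_s_attained T : ~~ constant_table T ->
  exists2 G, snd_tree T G & tree_measure psi G = psi_s psi T.
Proof.
move=> ncT; have [|G hG _] := @snd_tree_bounded T #|` attrs T| ncT.
  move=> r rT rd; exists (row_word T r (attrs T)); split.
  - by rewrite size_map.
  - by rewrite row_word_attrs => f; rewrite -attrsE.
  - by rewrite sat_row_word //; apply/allP.
  - move=> s sT; rewrite sat_row_word // => /allP sr.
    rewrite (value_inj sT rT) // => f; rewrite -attrsE => fT; exact/eqP/sr.
rewrite /psi_s (negbTE ncT).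
have [|G' hG' <-] := @nat_min_mem
    [set tree_measure psi G | G in [set G | snd_tree T G]]%classic (tree_measure psi G).
  by exists G.
by exists G'.
Qed.

(** A path followed by a row forces decision 1, and every row with decision 1 follows a path.
    Consequently the decision depends only on the attributes of [G]. *)
Lemma snd_tree_dec T G r : snd_tree T G -> r \in rows T ->
  dec T r = has (fun p => sat T r p.1) (paths G).
Proof.
case=> _ _ _ cov hG rT; apply/idP/hasP => [rd|[p pG rp]].
  have [|p pG] := cov r; first by rewrite fnd_dec // rd.
  by rewrite mem_subtable => /andP[_ ?]; exists p.
have rw : r \in rows (subtable T p.1) by rewrite mem_subtable rT rp.
case: (hG p pG) => [/(subtable_neq_Lambda rw)//|/(_ r rw)].
by rewrite fnd_subtable // => -[].
Qed.

Definition distinguishes T r (D : {fset nat}) : Prop :=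
  D `<=` attrs T /\ forall s, s \in rows T -> s != r ->
    exists2 f, f \in D & value T r f != value T s f.

Lemma S_row_le_card T r D : distinguishes T r D -> S_row T r <= #|` D|.
Proof. by move=> hD; apply: nat_min_le; exists D. Qed.

Lemma S_row_attained T r : r \in rows T ->
  exists2 D, distinguishes T r D & #|` D| = S_row T r.
Proof.
move=> rT; rewrite /S_row; set X := (X in nat_min X).
have [|D hD <-] := @nat_min_mem X #|` attrs T|; last by exists D.
exists (attrs T) => //; split=> // s sT sr.
have [[f fT fv]|noD] := pselect (exists2 f, f \in attrs T & value T r f != value T s f).
  by exists f.
case/eqP: sr; apply: (value_inj sT rT) => f fT; apply/eqP; rewrite eq_sym; apply/negPn/negP => fv.
by case: noD; exists f => //; rewrite attrsE.
Qed.

Lemma S_row_le T r : r \in rows T -> S_row T r <= S_ T.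
Proof. by move=> rT; apply: (leq_bigmax_seq (F := fun r => S_row T r)). Qed.

End Complexity.

(** * Bounds on [S_] and [psi_d] inside a closed class *)

Section Class.
Variables (k : nat) (psi : seq nat -> nat) (A : set (table k)).
Hypothesis hpsi : complexity_measure psi.
Hypothesis hbounded : bounded_measure psi.
Hypothesis k_gt0 : 0 < k.
Hypothesis hA : closed_class A.
Implicit Types (T : table k) (r : seq 'I_k) (w : seq (nat * 'I_k)) (G : tree k).

Lemma restr_class T E nu : A T -> A (restr T E nu).
Proof.
move=> AT; case: hA => _ <-; exists T => //.
by exists (attrs T `\` E), nu; split=> //; apply: fsubsetDl.
Qed.

Lemma restr_V T (E : {fset nat}) nu n : E `<=` attrs T -> E != fset0 ->
  (forall f, f \in E -> psi [:: f] <= n) -> V_ psi (restr T E nu) <= n.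
Proof. by move=> ET E0 En; apply: V_le => f; rewrite mem_cols_restr // => /En. Qed.

Lemma restr_V_le T (E : {fset nat}) nu n : E `<=` attrs T -> E != fset0 ->
  V_ psi T <= n -> V_ psi (restr T E nu) <= n.
Proof.
move=> ET E0 Tn; apply: restr_V => // f fE; apply: leq_trans Tn.
by apply: psi_cols; rewrite -attrsE (fsubsetP ET).
Qed.

Lemma sat_restr T (E : {fset nat}) nu r w : E `<=` attrs T -> E != fset0 -> r \in rows T ->
  {subset unzip1 w <= E} -> sat (restr T E nu) (keep T E r) w = sat T r w.
Proof.
move=> ET E0 rT wE; apply: eq_in_all => -[f a] fw /=.
by rewrite value_restr //; apply/wE/mapP; exists (f, a).
Qed.

(** By minimality, [D] without [f] fails to separate [r] from some [s]; since [D] separates them,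
    [f] is the only attribute of [D] that does. *)
Lemma critical_row T r D f : r \in rows T -> distinguishes T r D -> #|` D| = S_row T r ->
  f \in D -> exists s, [/\ s \in rows T, value T r f != value T s f &
    forall g, g \in D -> g != f -> value T s g = value T r g].
Proof.
move=> rT [DT hD] Dmin fD.
have [//|no_s] := pselect (exists s, [/\ s \in rows T, s != r &
    forall g, g \in D -> g != f -> value T s g = value T r g]).
  case=> s [sT sr sD]; exists s; split=> //.
  have [g gD gv] := hD s sT sr; have [<-//|gf] := eqVneq g f.
  by rewrite sD ?eqxx in gv.
have : S_row T r <= #|` D `\ f|; last by rewrite -Dmin (cardfsD1 f D) fD ltnn.
apply: S_row_le_card; split; first exact: fsubset_trans (fsubD1set _ _) DT.
move=> s sT sr; have [[g gD gv]|no_g] :=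
    pselect (exists2 g, g \in D `\ f & value T r g != value T s g); first by exists g.
case: no_s; exists s; split=> // g gD gf; apply/eqP; rewrite eq_sym.
by apply/negPn/negP => gv; case: no_g; exists g => //; rewrite in_fsetD1 gf.
Qed.

(* Recolour so that only [r] has decision 0: a deterministic tree must then query
   every attribute of a minimal distinguishing set along the path of [r]. *)
Lemma S_le_F T n v : A T -> V_ psi T <= n -> F_class psi A n = Some v -> S_ T <= v.
Proof.
move=> AT Tn Fn; apply/bigmax_leqP_seq => r rT _.
have [D dD Dmin] := S_row_attained rT; rewrite -Dmin.
have [->|D0] := eqVneq D fset0; first by rewrite cardfs0.
have [DT hD] := dD.
pose nu t := t != keep T D r; pose T' := restr T D nu.
have rT' : keep T D r \in rows T' by apply: keep_restr.
(* Each other row differs from the projection of [r] at some attribute of [D]; querying this one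
   attribute certifies decision 1. *)
have T's : psi_s psi T' <= n.
  apply: leq_trans (_ : V_ psi T' * 1 <= n); last by rewrite muln1 restr_V_le.
  apply: psi_s_le => // t tT' td; have [s sT tE] := restr_keep DT D0 tT'.
  have sr : s != r by apply: contraL td => /eqP sr; rewrite dec_restr // tE sr /nu eqxx.
  have [f fD fv] := hD s sT sr.
  have [a sa] : exists a, value T s f = Some a.
    by apply: value_cols => //; rewrite -attrsE (fsubsetP DT).
  exists [:: (f, a)]; split=> //.
  - by move=> g; rewrite inE => /eqP->; rewrite mem_cols_restr.
  - by rewrite /sat /= tE value_restr // sa eqxx.
  - move=> u uT'; rewrite /sat /= andbT dec_restr // /nu => ua.
    by apply: contra fv => /eqP uE; move: ua; rewrite uE value_restr // sa.
have T'd : psi_d psi T' <= v.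
  by apply: nat_max_ge Fn _; exists T' => //; split=> //; apply: restr_class.
have [G hG Gm] := psi_d_attained psi k_gt0 (row_neq_Lambda rT').
have [p pG rp] := det_tree_cover hG rT'.
apply: leq_trans T'd; rewrite -Gm; apply: leq_trans (path_measure psi pG).
(* Boundedness turns the measure into a length, which is at least the size of [D] once all of [D]
   occurs on [p]. *)
apply: leq_trans (hbounded _); apply: uniq_leq_size => // f fD.
apply/negPn/negP => fp.
(* If [f] is not queried, the critical row for [f] follows [p] as well and gets the decision of [r],
   although only [r] has decision 0. *)
have [s [sT sf sD]] := critical_row rT dD Dmin fD.
have sT' : keep T D s \in rows T' by apply: keep_restr.
have sp : sat T' (keep T D s) p.1.
  apply/allP => -[g a] gp; have /= ra := allP rp _ gp.
  have gf : g != f.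
    by apply: contraNneq fp => <-; apply/mapP; exists (g, a).
  have gD : g \in D.
    rewrite -(mem_cols_restr nu DT D0); apply: contraLR ra => gT'.
    by rewrite value_notin.
  by rewrite /= value_restr // sD // -(value_restr nu DT D0).
have := det_tree_sat hG pG rT' rp; rewrite -(det_tree_sat hG pG sT' sp).
rewrite !dec_restr // /nu eqxx => /esym/negbFE/eqP sr.
by rewrite -(value_restr nu DT D0 sT fD) sr value_restr ?eqxx in sf.
Qed.

(* If no row agrees with [delta], take a minimal [D] on which none does: any row
   agreeing with [delta] off one attribute of [D] has a large [S_row]. *)
Lemma certificate_exists T n s : T <> Lambda -> A T -> V_ psi T <= n ->
  (forall T', A T' -> V_ psi T' <= n -> S_ T' <= s) ->
  forall delta : nat -> 'I_k, exists D,
    [/\ size D <= s.+1, {subset D <= cols T} &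
      forall r t, r \in rows T -> t \in rows T ->
        agree T delta D r -> agree T delta D t -> r = t].
Proof.
move=> TL AT Tn Ss delta.
have [[r rT /allP rd]|noall] :=
    pselect (exists2 r, r \in rows T & agree T delta (cols T) r).
  (* Here [delta] is the row [r], and a minimal distinguishing set isolates it with at most [s]
     attributes. *)
  have [D [DT hD] Dmin] := S_row_attained rT.
  exists (enum_fset D); split.
  - by rewrite Dmin (leq_trans (S_row_le rT)) // (leq_trans (Ss T AT Tn)).
  - by move=> f fD; rewrite -attrsE (fsubsetP DT).
  - suff tr t : t \in rows T -> agree T delta (enum_fset D) t -> t = r.
      by move=> t u tT uT /(tr t tT)-> /(tr u uT)->.
    move=> tT /allP td; apply/eqP; apply/negPn/negP => tr.
    have [f fD] := hD t tT tr.
    rewrite (eqP (td f fD)) (eqP (rd f _)) ?eqxx //.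
    by rewrite -attrsE (fsubsetP DT).
pose clash (D : {fset nat}) := D `<=` attrs T /\
  forall r, r \in rows T -> ~~ agree T delta (enum_fset D) r.
pose X := [set #|` D| | D in [set D | clash D]]%classic.
have [|D [DT Dno] Dmin] := @nat_min_mem X #|` attrs T|.
  exists (attrs T) => //; split=> // r rT; apply/negP => /allP rd.
  by case: noall; exists r => //; apply/allP => f; rewrite -attrsE; apply: rd.
(* Minimality of [D]: without [f] some row agrees with [delta]. *)
have agree_rem f : f \in D -> exists2 r, r \in rows T &
    forall g, g \in D -> g != f -> value T r g = Some (delta g).
  move=> fD; have [[r rT /allP rd]|no_r] :=
      pselect (exists2 r, r \in rows T & agree T delta (enum_fset (D `\ f)) r).
    by exists r => // g gD gf; apply/eqP/rd; rewrite in_fsetD1 gf.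
  have : nat_min X <= #|` D `\ f|; last by rewrite -Dmin (cardfsD1 f D) fD ltnn.
  apply: nat_min_le; exists (D `\ f) => //; split.
    exact: fsubset_trans (fsubD1set _ _) DT.
  by move=> r rT; apply/negP => rd; case: no_r; exists r.
exists (enum_fset D); split; first last.
- by move=> r t rT _ rd; rewrite (negbTE (Dno r rT)) in rd.
- by move=> f fD; rewrite -attrsE (fsubsetP DT).
have [f0 f0D] : exists f, f \in D.
  apply/fset0Pn/eqP => D0; have [r rT] := table_neq_Lambda TL.
  by have := Dno r rT; rewrite D0.
(* The removed [f0] accounts for the successor in [s.+1]. *)
have -> : size (enum_fset D) = #|` D `\ f0|.+1 by rewrite [LHS](cardfsD1 f0 D) f0D.
rewrite ltnS; set D0 := D `\ f0.
have [->|D00] := eqVneq D0 fset0; first by rewrite cardfs0.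
have D0T : D0 `<=` attrs T by apply: fsubset_trans (fsubD1set _ _) DT.
have [r rT rd] := agree_rem f0 f0D.
pose T' := restr T D0 (fun=> false).
have rT' : keep T D0 r \in rows T' by apply: keep_restr.
have [D1 [D1T' hD1] D1min] := S_row_attained rT'.
apply: leq_trans (Ss T' _ _); [|exact: restr_class|exact: restr_V_le].
apply: leq_trans (S_row_le rT'); rewrite -D1min; apply: fsubset_leq_card.
rewrite attrs_restr // in D1T'.
(* On [D0] the row [r] agrees with [delta], and the row [t] found for [f] does so except at [f];
   hence [D1] can separate them only by containing [f]. *)
apply/fsubsetP => f fD0; have := fD0; rewrite in_fsetD1 => /andP[ff0 fD].
have [t tT td] := agree_rem f fD.
have tf : value T t f != Some (delta f).
  apply: contra (Dno t tT) => /eqP tf; apply/allP => g gD; apply/eqP.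
  by have [->//|gf] := eqVneq g f; apply: td.
have [||g gD1] := hD1 (keep T D0 t); first exact: keep_restr.
  apply: contra tf => /eqP tr; have := value_restr (fun=> false) D0T D00 tT fD0.
  by rewrite tr value_restr // rd // => <-.
have gD0 := fsubsetP D1T' g gD1.
rewrite !value_restr //; have := gD0; rewrite in_fsetD1 => /andP[gf0 gD].
by have [<-//|gf] := eqVneq g f; rewrite rd // td // eqxx.
Qed.

(** Each attribute of an optimal strongly nondeterministic tree has weight at most [n], so the
    restriction to these attributes satisfies [V_ <= n] even if [T] does not, and its deterministic
    tree also works for [T]. *)
Lemma psi_d_le_class T n s m : A T -> psi_s psi T <= n ->
  (forall T', A T' -> V_ psi T' <= n -> S_ T' <= s) ->
  (forall T', A T' -> V_ psi T' <= n -> N_ T' <= 2 ^ m) ->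
  psi_d psi T <= n * (s.+1 * m).
Proof.
move=> AT Ts Ss Nm; have [cT|ncT] := boolP (constant_table T).
  have [|//|G [hG G0]] := @det_tree_bounded _ k_gt0 T 0 (N_ T).
  - by move=> delta; exists [::]; split=> // r t rT tT _ _; apply: (constant_tableP T cT).
  - exact/ltnW/ltn_expl.
  apply: leq_trans (psi_d_le psi hG) _.
  have [_ _ GT _ _] := hG; have := tree_measure_le hpsi GT G0.
  by rewrite mul0n muln0 leqn0 => /eqP->.
have [G hG Gm] := psi_s_attained hpsi k_gt0 ncT; rewrite -Gm in Ts.
pose E := tree_attrs G; have [okG _ ET _ _] := hG.
have E0 : E != fset0.
  (* Without attributes all path words are empty, so all rows follow the same paths. *)
  apply: contra ncT => /eqP E0; apply/constant_tableP => r t rT tT.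
  rewrite !(snd_tree_dec hG) //; apply: eq_in_has => p pG.
  case: p pG => -[|[f a] w] d pG //.
  by have := paths_attrs pG (mem_head f _); rewrite -/E E0.
have pE p : p \in paths G -> {subset unzip1 p.1 <= E} by move=> pG f; apply: paths_attrs.
pose nu t := `[< exists r, [/\ r \in rows T, t = keep T E r & dec T r] >].
pose T' := restr T E nu.
have decE r : r \in rows T -> dec T' (keep T E r) = dec T r.
  (* [nu] is consistent: rows with equal projections follow the same paths of [G] and so have equal
     decisions. *)
  move=> rT; rewrite dec_restr ?keep_restr //; apply/asboolP/idP => [[t [tT tr td]]|rd].
    rewrite (snd_tree_dec hG rT) -(eq_in_has (a1 := fun p => sat T t p.1)) -?(snd_tree_dec hG) //.
    move=> p pG; rewrite -(sat_restr nu ET E0 tT (pE p pG)).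
    by rewrite -(sat_restr nu ET E0 rT (pE p pG)) tr.
  by exists r.
have AT' : A T' by apply: restr_class.
have T'n : V_ psi T' <= n.
  apply: restr_V => // f /(attrs_paths okG)[p pG fp].
  by apply: leq_trans Ts; apply: leq_trans (psi1_le hpsi fp) (path_measure _ pG).
have T'L : T' <> Lambda.
  have [r rT] : exists r, r \in rows T.
    apply: table_neq_Lambda => TL; case/negP: ncT; apply/constant_tableP => r t.
    by rewrite TL.
  exact: (row_neq_Lambda (keep_restr nu ET E0 rT)).
have [delta||G' [hG' G'd]] := @det_tree_bounded _ k_gt0 T' s.+1 m.
- have [D [Ds DT hD]] := certificate_exists T'L AT' T'n Ss delta.
  by exists D; split=> // r t rT tT rd td; congr dec; apply: hD.
- exact: Nm.
have [ok' det' G'T' _ _] := hG'.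
have G'E : tree_attrs G' `<=` E by move: G'T'; rewrite attrs_restr.
have p'E p : p \in paths G' -> {subset unzip1 p.1 <= E}.
  by move=> pG f fp; apply: (fsubsetP G'E); apply: paths_attrs fp.
apply: (@leq_trans (tree_measure psi G')); last first.
  apply: leq_trans (tree_measure_le hpsi G'T' G'd) _.
  by rewrite leq_mul2r T'n orbT.
(* [G'] queries only [E], so a row of [T] follows the same paths as its projection. *)
apply: psi_d_le; split=> //; first exact: fsubset_trans ET.
  move=> r rT; have [p pG rp] := det_tree_cover hG' (keep_restr nu ET E0 rT).
  by exists p => //; rewrite mem_subtable rT -(sat_restr nu ET E0 rT (p'E p pG)).
move=> p pG; right => r rw; rewrite fnd_subtable //.
move: rw; rewrite mem_subtable => /andP[rT rp].
rewrite -decE // (det_tree_sat hG' pG) ?keep_restr //.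
by rewrite sat_restr //; apply: p'E.
Qed.

End Class.

(** * Counting the colourings computed by trees of bounded depth *)

Lemma leq_exp2rW (m n e : nat) : m <= n -> m ^ e <= n ^ e.
Proof. by case: (posnP e) => [->//|e_gt0]; rewrite leq_exp2r. Qed.

Section Counting.
Variables (k : nat) (I : finType) (E : {fset nat}) (vl : I -> nat -> option 'I_k).

Definition query (f : nat) (g : {ffun 'I_k -> {ffun I -> bool}}) : {ffun I -> bool} :=
  [ffun i => if vl i f is Some a then g a i else false].

(** A tree is identified with the colouring of [I] that it computes. There are exactly [h] levels of
    queries; shallower trees are padded by [const_computable]. *)
Fixpoint computable (h : nat) : {set {ffun I -> bool}} :=
  if h is h'.+1 then
    [set query (val x.1) x.2 | x in finset.setX [set: E]%SET
      [set g : {ffun 'I_k -> {ffun I -> bool}} | g \in ffun_on (computable h')]%SET]%SET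
  else [set [ffun=> b] | b : bool]%SET.

Lemma query_computable h f (g : {ffun 'I_k -> {ffun I -> bool}}) :
  f \in E -> (forall a, g a \in computable h) ->
  query f g \in computable h.+1.
Proof.
move=> fE gh; apply/imsetP; exists ([` fE], g) => //.
by rewrite finset.in_setX !inE; apply/ffun_onP.
Qed.

(** A query is an attribute with [k] colourings of the previous level, so the exponent obeys [l + k
    * (l * k.+1 ^ h) <= l * k.+1 ^ h.+1]. *)
Lemma card_computable l h : 0 < l -> #|` E| <= 2 ^ l ->
  #|computable h| <= 2 ^ (l * k.+1 ^ h).
Proof.
move=> l_gt0 El; elim: h => [|h IH].
  rewrite muln1; apply: leq_trans (leq_imset_card _ _) _.
  by rewrite card_bool -[2]/(2 ^ 1) leq_exp2l.
apply: leq_trans (leq_imset_card _ _) _; rewrite cardsX cardsT -cardfE.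
have -> : #|[set g : {ffun 'I_k -> {ffun I -> bool}} | g \in ffun_on (computable h)]%SET|
    = #|computable h| ^ k.
  by rewrite cardsE card_ffun_on card_ord.
apply: (@leq_trans (2 ^ l * (2 ^ (l * k.+1 ^ h)) ^ k)).
  by rewrite leq_mul // leq_exp2rW.
rewrite -expnM -expnD leq_exp2l // expnS mulSn mulnDr leq_add //.
  by rewrite leq_pmulr // expn_gt0.
by rewrite -mulnA (mulnC k).
Qed.

Hypothesis E_neq0 : E != fset0.
Hypothesis vl_some : forall i f, f \in E -> exists a, vl i f = Some a.

(** A query whose answers all lead to the same colouring changes nothing; [E_neq0] provides an
    attribute to ask. *)
Lemma const_computable b h : [ffun=> b] \in computable h.
Proof.
have [f fE] := fset0Pn _ E_neq0; elim: h => [|h IH]; first by apply/imsetP; exists b.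
have -> : [ffun=> b] = query f [ffun=> [ffun=> b]].
  by apply/ffunP => i; rewrite !ffunE; case: (vl_some i fE) => a ->; rewrite !ffunE.
by apply: query_computable => // a; rewrite ffunE.
Qed.

Lemma node_computable h (v : node k) :
  node_det v -> {subset node_attrs v <= E} ->
  (forall p, p \in node_paths v -> size p.1 <= h) ->
  exists2 g, g \in computable h & forall i p, p \in node_paths v ->
    all (fun fd => vl i fd.1 == Some fd.2) p.1 -> g i = p.2.
Proof.
elim: h v => [|h IH] [d|f es] detv attrv sz.
- exists [ffun=> d]; first exact: const_computable.
  by move=> i p; rewrite inE => /eqP-> _; rewrite ffunE.
(* Every path of a working node has positive length, so at depth 0 the claim is vacuous. *)
- exists [ffun=> false]; first exact: const_computable.
  by move=> i p pv; have := sz p pv; case/work_pathP: pv => e [q [_ _ ->]].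
- exists [ffun=> d]; first exact: const_computable.
  by move=> i p; rewrite inE => /eqP-> _; rewrite ffunE.
have /= /andP[es_uniq /allP es_det] := detv.
have fE : f \in E by apply: attrv; rewrite mem_head.
have /choice[g hg] a : exists g, g \in computable h /\
    forall e, e \in es -> e.1 = a -> forall i p, p \in node_paths e.2 ->
      all (fun fd => vl i fd.1 == Some fd.2) p.1 -> g i = p.2.
  have [/hasP[e ees /eqP ea]|no_e] := boolP (has (fun e => e.1 == a) es); last first.
    exists [ffun=> false]; split; first exact: const_computable.
    by move=> e ees ea; case/hasP: no_e; exists e; rewrite ?ea.
  have [||p pe|g gh hg] := IH e.2.
  - exact: es_det.
  - by move=> f' f'e; apply: attrv; rewrite inE; apply/orP; right; apply/flatten_mapP; exists e.
  - have := sz ((f, e.1) :: p.1, p.2); apply.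
    by apply/work_pathP; exists e, p.
  - exists g; split=> // e' e'es e'a.
    suff -> : e' = e by [].
    rewrite -e'a in ea; move: es_uniq e'es ees ea.
    elim: (es) => // e0 es' IHes /= /andP[e0es' u].
    rewrite !inE => /orP[/eqP->|e'es'] /orP[/eqP->|ees'] ea //; last exact: IHes.
      by case/negP: e0es'; apply/mapP; exists e.
    by case/negP: e0es'; apply/mapP; exists e'.
exists (query f [ffun a => g a]).
  by apply: query_computable => // a; rewrite ffunE; case: (hg a).
move=> i p /work_pathP[e [q [ees qe ->]]] /= /andP[/eqP ie iq].
by rewrite ffunE ie ffunE; case: (hg e.1) => _ /(_ e ees erefl i q qe iq).
Qed.

End Counting.

(** With [l ^ 2 <= 4 * 2 ^ l] the hypotheses give [N ^ 2 <= l ^ 2 * K ^ 2 <= 8 * N * K ^ 2]; then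
    divide by [N]. *)
Lemma leq_log_square (N l K : nat) : 2 ^ l <= N.*2 -> N <= l * K -> N <= 8 * K ^ 2.
Proof.
have sq m : m ^ 2 <= 4 * 2 ^ m.
  elim: m => [//|[|[|[|m]]] IH] //.
  rewrite [2 ^ _.+1]expnS mulnCA mul2n -addnn; apply: leq_trans (leq_add IH IH).
  by rewrite -!mulnn; nia.
move=> Nl NK; have [->//|N_gt0] := posnP N.
rewrite -(leq_pmul2l N_gt0); apply: (@leq_trans ((l * K) ^ 2)).
  by rewrite -mulnn leq_mul.
rewrite expnMn mulnA leq_mul2r; apply/orP; right.
by apply: leq_trans (sq l) _; lia.
Qed.

(** * Bounding the number of rows through their colourings *)

Section Colourings.
Variables (k : nat) (psi : seq nat -> nat) (A : set (table k)).
Hypothesis hpsi : complexity_measure psi.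
Hypothesis hbounded : bounded_measure psi.
Hypothesis k_gt0 : 0 < k.
Hypothesis hA : closed_class A.
Implicit Types (T : table k) (r : seq 'I_k).

(** By induction on the rows: a new row coincides on [E] with at most one earlier row, and one
    further attribute separates these two. *)
Lemma separating_attrs T : exists E : {fset nat}, [/\ E `<=` attrs T, #|` E| <= N_ T &
  forall r s, r \in rows T -> s \in rows T ->
    {in E, value T r =1 value T s} -> r = s].
Proof.
suff sep (X : seq (seq 'I_k)) : {subset X <= rows T} -> exists E : {fset nat},
    [/\ E `<=` attrs T, #|` E| <= size X &
    {in X &, forall r s, {in E, value T r =1 value T s} -> r = s}].
  exact: (sep (enum_fset (domf (rows T)))).
elim: X => [|r X IH] XT; first by exists fset0; rewrite cardfs0; split=> //; apply: fsub0set.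
have [|E [ET EX hE]] := IH; first by move=> s sX; apply: XT; rewrite inE sX orbT.
have rT : r \in rows T by apply: XT; rewrite mem_head.
have [[s [sX sr rs]]|no_s] :=
    pselect (exists s, [/\ s \in X, s != r & {in E, value T r =1 value T s}]); last first.
  exists E; split=> //; first exact: leqW.
  have rX s : s \in X -> {in E, value T r =1 value T s} -> r = s.
    move=> sX rs; apply/eqP; rewrite eq_sym; apply/negPn/negP => sr.
    by case: no_s; exists s.
  move=> s t; rewrite !inE => /orP[/eqP->|sX] /orP[/eqP->|tX] // st; first exact: rX.
    by apply/esym/rX => // f fE; rewrite st.
  exact: hE.
have sT : s \in rows T by apply: XT; rewrite inE sX orbT.
have [f fT fv] : exists2 f, f \in attrs T & value T r f != value T s f.
  have [//|no_f] := pselect (exists2 f, f \in attrs T & value T r f != value T s f).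
  case/eqP: sr; apply: (value_inj sT rT) => f fT; apply/eqP.
  rewrite eq_sym; apply/negPn/negP => fv; case: no_f.
  by exists f; rewrite ?attrsE.
exists (f |` E); split.
- by rewrite fsubUset fsub1set fT.
- by rewrite cardfsU1 /=; apply: (@leq_add _ _ 1) => //; apply: leq_b1.
have rX t : t \in X -> {in f |` E, value T r =1 value T t} -> r = t.
  move=> tX rt; have st : s = t.
    by apply: hE => // g gE; rewrite -rs // rt // in_fsetU gE orbT.
  by move: fv; rewrite st rt ?eqxx // fset1U1.
have EfE t u : {in f |` E, value T t =1 value T u} -> {in E, value T t =1 value T u}.
  by move=> tu g gE; apply: tu; rewrite in_fsetU gE orbT.
move=> t u; rewrite !inE => /orP[/eqP->|tX] /orP[/eqP->|uX] // tu; first exact: rX.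
  by apply/esym/rX => // g gE; rewrite tu.
exact/hE/EfE.
Qed.

(* Every colouring of the rows of [T] is computed by a tree of depth at most [h]
   over at most [N_ T] attributes, and there are few such trees. *)
Lemma N_le_class T n s h : A T -> V_ psi T <= n ->
  (forall T', A T' -> V_ psi T' <= n -> S_ T' <= s) ->
  F_class psi A (n * s) = Some h ->
  N_ T <= 8 * (k.+1 ^ h) ^ 2.
Proof.
move=> AT Tn Ss Fh; have [N1|N_gt1] := leqP (N_ T) 1.
  by apply: leq_trans N1 _; rewrite muln_gt0 /= !expn_gt0.
have [E [ET EN sepE]] := separating_attrs T.
have E0 : E != fset0.
  apply/eqP => E0; have all_eq r t : r \in rows T -> t \in rows T -> r = t.
    by move=> rT tT; apply: sepE => // f; rewrite E0.
  have memT r : r \in enum_fset (domf (rows T)) -> r \in rows T by [].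
  move: N_gt1 (fset_uniq (domf (rows T))) memT; rewrite /N_.
  case: (enum_fset _) => [|r [|t X]] //= _ /andP[+ _] memT.
  by rewrite (all_eq r t) ?mem_head ?memT // !inE eqxx ?orbT.
pose I : finType := domf (rows T).
pose vl (i : I) f := value T (val i) f.
have vl_some i f : f \in E -> exists a, vl i f = Some a.
  move=> fE; apply: value_cols; first exact: valP.
  by rewrite -attrsE (fsubsetP ET).
have keep_inj r t : r \in rows T -> t \in rows T -> keep T E r = keep T E t -> r = t.
  move=> rT tT rt; apply: sepE => // f fE.
  by rewrite -(value_restr (fun=> false) ET E0 rT fE) rt value_restr.
have all_computable (c : {ffun I -> bool}) : c \in computable E vl h.
  (* The colouring [c] carried over to the projected rows, which [keep_inj] makes possible. *)
  pose nu t := [exists i : I, (keep T E (val i) == t) && c i].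
  have nuE i : nu (keep T E (val i)) = c i.
    apply/existsP/idP => [[j /andP[/eqP ji cj]]|ci]; last by exists i; rewrite eqxx.
    by rewrite -(val_inj (keep_inj _ _ (valP j) (valP i) ji)).
  pose T' := restr T E nu.
  have AT' : A T' by apply: restr_class.
  have T'n : V_ psi T' <= n by apply: restr_V_le.
  have T's : psi_s psi T' <= n * s.
    apply: leq_trans (_ : V_ psi T' * s <= _); last by rewrite leq_mul2r T'n orbT.
    apply: psi_s_le => // t tT' td; have [D [DT' hD] Dmin] := S_row_attained tT'.
    exists (row_word k_gt0 T' t D); split.
    - by rewrite size_map Dmin; apply: leq_trans (S_row_le tT') _; apply: Ss.
    - by rewrite row_word_attrs => f fD; rewrite -attrsE (fsubsetP DT').
    - by rewrite sat_row_word //; apply/allP.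
    - move=> u uT'; rewrite sat_row_word // => /allP ut.
      have [->//|u_t] := eqVneq u t.
      by have [f fD] := hD u uT' u_t; rewrite eq_sym (ut f fD).
  have T'h : psi_d psi T' <= h by apply: nat_max_ge Fh _; exists T'.
  have T'L : T' <> Lambda.
    have [r rT] : exists r, r \in rows T.
      by apply: table_neq_Lambda => TL; rewrite TL in N_gt1.
    exact: (row_neq_Lambda (keep_restr nu ET E0 rT)).
  have [G hG Gm] := psi_d_attained psi k_gt0 T'L.
  have [_ [G1 Gdet] GT' _ _] := hG.
  have Gh p : p \in paths G -> size p.1 <= h.
    move=> pG; apply: leq_trans T'h; rewrite -Gm; apply: leq_trans (path_measure psi pG).
    by rewrite -(size_map fst); apply: hbounded.
  have GE p : p \in paths G -> {subset unzip1 p.1 <= E}.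
    by move=> pG f /(paths_attrs pG) /(fsubsetP GT'); rewrite attrs_restr.
  have [v Gv] : exists v, G = [:: v] by case: (G) G1 => [|v []] // _; exists v. 
  rewrite Gv paths1 in Gh GE; rewrite Gv /= andbT in Gdet.
  have [|g gh hg] := node_computable E0 vl_some Gdet _ Gh.
    move=> f fv; rewrite -(attrs_restr nu ET E0); apply: (fsubsetP GT').
    by rewrite Gv tree_attrsE /= cats0.
  suff -> : c = g by [].
  apply/ffunP => i; have iT : val i \in rows T by apply: valP.
  have [p pG ip] := det_tree_cover hG (keep_restr nu ET E0 iT).
  have pv : p \in node_paths v by rewrite -paths1 -Gv.
  rewrite -nuE -(dec_restr (keep_restr nu ET E0 iT)) (det_tree_sat hG pG _ ip).
    rewrite (hg i p pv) //; exact: (etrans (esym (sat_restr nu ET E0 iT (GE p pv))) ip).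
  exact: keep_restr.
(* The least [l] with [N_ T <= 2 ^ l], so that also [2 ^ l <= (N_ T).*2]. *)
pose l := up_log 2 (N_ T).
have l_gt0 : 0 < l by rewrite up_log_gt0.
have Nl : N_ T <= 2 ^ l by apply: up_logP.
apply: (@leq_log_square _ l).
  by rewrite -(prednK l_gt0) expnS mul2n leq_double ltnW // up_log_gtn.
have := card_computable vl h l_gt0 (leq_trans EN Nl).
have -> : #|computable E vl h| = 2 ^ N_ T.
  rewrite -[2]card_bool -[N_ T]/(#|` domf (rows T)|) cardfE -card_ffun.
  by apply: eq_card => c; rewrite all_computable.
by rewrite leq_exp2l.
Qed.

End Colourings.

(** * Polynomial bounds and the equivalence *)

Lemma poly_le_monomial (R : realType) (p : {poly R}) : exists c d : nat,
  forall n : nat, (p.[n%:R] <= (c * n.+1 ^ d)%:R)%R.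
Proof.
elim/poly_ind: p => [|p a [c [d pcd]]].
  by exists 0, 0 => n; rewrite horner0 mul0n.
(* The base [n.+1] keeps powers positive at [n = 0], so the new constant term is absorbed. *)
exists (c + Num.bound `|a|%R), d.+1 => n; rewrite hornerMXaddC.
apply: (@le_trans _ _ ((c * n.+1 ^ d)%:R * n%:R + (Num.bound `|a|)%:R))%R.
  apply: lerD; first by rewrite ler_wpM2r.
  by apply: le_trans (ler_norm a) (ltW (archi_boundP _)).
rewrite -natrM -natrD ler_nat mulnDl leq_add //.
  by rewrite expnSr -!mulnA !leq_mul.
by rewrite leq_pmulr // expn_gt0.
Qed.

Lemma monomial_poly (R : realType) (c d : nat) : exists p : {poly R},
  forall n : nat, p.[n%:R]%R = (c * n.+1 ^ d)%:R%R.
Proof.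
exists (c%:R *: ('X + 1) ^+ d)%R => n.
by rewrite hornerZ horner_exp hornerD hornerX hornerC natrM natrX natr1.
Qed.

Lemma defined_le_nat (R : realType) (o : option nat) (v b : nat) :
  o = Some v -> v <= b -> defined_le o (b%:R : R)%R.
Proof. by move=> -> vb; exists v; rewrite ?ler_nat. Qed.

Lemma powR2_nat (R : realType) (b : nat) : ((2 : R) `^ b%:R = (2 ^ b)%:R)%R.
Proof. by rewrite powR_mulrn // natrX. Qed.

Local Open Scope ring_scope.

Theorem theorem6 (R : realType) (k : nat) (hk : (2 <= k)%N)
    (psi : seq nat -> nat)
    (hpsi : complexity_measure psi) (hbounded : bounded_measure psi)
    (A : set (table k)) (hA : closed_class A)
    (hF : forall n : nat, F_class psi A n <> None) :
  (exists p0 : {poly R}, forall n : nat,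
      defined_le (F_class psi A n) p0.[n%:R])
  <->
  (exists p1 p2 : {poly R}, forall n : nat,
      defined_le (S_class psi A n) p1.[n%:R] /\
      defined_le (N_class psi A n) (2 `^ p2.[n%:R])).
Proof.
have k_gt0 : (0 < k)%N by apply: ltnW.
split=> [[p0 hp0]|[p1 [p2 hp]]].
  have [c [d p0cd]] := poly_le_monomial p0.
  pose v n := odflt 0%N (F_class psi A n).
  have Fv n : F_class psi A n = Some (v n).
    by rewrite /v; case: F_class (hF n).
  have vcd n : (v n <= c * n.+1 ^ d)%N.
    by case: (hp0 n) => x; rewrite Fv => -[<-] vp0; rewrite -(ler_nat R) (le_trans vp0).
  have Sv n T : A T -> (V_ psi T <= n)%N -> (S_ T <= v n)%N.
    by move=> AT Tn; apply: S_le_F Tn (Fv n).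
  have [p1 hp1] := monomial_poly R c d.
  (* The exponent [d.+1 * d] comes from [h <= c * (n * v n).+1 ^ d] and
     [(n * v n).+1 <= c.+1 * n.+1 ^ d.+1]. The terms 3 and [2 * k] come from [8 * (k.+1 ^ h) ^ 2 <=
     2 ^ (3 + 2 * k * h)], as [k.+1 <= 2 ^ k]. *)
  have [p2 hp2] := monomial_poly R (3 + 2 * k * (c * c.+1 ^ d))%N (d.+1 * d)%N.
  exists p1, p2 => n; split.
    have [|s Ss sv] := @nat_max_def [set S_ T | T in A_below psi A n]%classic (v n).
      by move=> _ [T [AT Tn] <-]; apply: Sv.
    by rewrite hp1; apply: defined_le_nat Ss (leq_trans sv (vcd n)).
  pose h := v (n * v n)%N.
  have h_le : (h <= c * c.+1 ^ d * n.+1 ^ (d.+1 * d))%N.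
    apply: leq_trans (vcd _) _; rewrite -mulnA leq_mul2l expnM -expnMn leq_exp2rW ?orbT //.
    rewrite mulSn -addn1 addnC leq_add ?expn_gt0 // expnS mulnCA leq_mul //.
  rewrite hp2 powR2_nat.
  have [|N NE Nb] := @nat_max_def [set N_ T | T in A_below psi A n]%classic
      (8 * (k.+1 ^ h) ^ 2)%N.
    by move=> _ [T [AT Tn] <-]; apply: (N_le_class hpsi hbounded k_gt0 hA AT Tn (Sv n)).
  apply: defined_le_nat NE (leq_trans Nb _).
  apply: (@leq_trans (2 ^ (3 + k * h * 2)))%N.
    rewrite expnD leq_mul // [in leqRHS]expnM leq_exp2r // expnM leq_exp2rW //.
    exact: ltn_expl.
  rewrite leq_exp2l // mulnDl leq_add ?leq_pmulr ?expn_gt0 //.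
  by rewrite mulnAC (mulnC k) -[leqRHS]mulnA leq_mul2l h_le orbT.
have [c1 [d1 p1cd]] := poly_le_monomial p1.
have [c2 [d2 p2cd]] := poly_le_monomial p2.
(* Shaped to bound [n * (s.+1 * m)] with [s <= c1 * n.+1 ^ d1] and [m = c2 * n.+1 ^ d2]; [c1.+1]
   absorbs the successor of [s]. *)
have [p0 hp0] := monomial_poly R (c1.+1 * c2)%N (1 + d1 + d2)%N.
exists p0 => n; case Fn: (F_class psi A n) (hF n) => [u|//] _.
rewrite hp0; apply: (@defined_le_nat _ _ u) => //.
have [[s Ss sp1] [N NE Np2]] := hp n.
have {sp1} s_le : (s <= c1 * n.+1 ^ d1)%N by rewrite -(ler_nat R) (le_trans sp1).
have {Np2} N_le : (N <= 2 ^ (c2 * n.+1 ^ d2))%N.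
  rewrite -(ler_nat R) -powR2_nat (le_trans Np2) // ler_powR //.
  by rewrite (ler_nat R 1 2).
apply: (@leq_trans (n * (s.+1 * (c2 * n.+1 ^ d2))))%N.
  apply: nat_max_le Fn _ => _ [T [AT Tn] <-].
  apply: (psi_d_le_class hpsi k_gt0 hA AT Tn) => T' AT' T'n.
    by apply: nat_max_ge Ss _; exists T'.
  by apply: leq_trans N_le; apply: nat_max_ge NE _; exists T'.
rewrite !expnD expn1.
apply: (@leq_trans (n.+1 * (c1.+1 * n.+1 ^ d1 * (c2 * n.+1 ^ d2))))%N; last by nia.
rewrite !leq_mul // mulSn -add1n leq_add ?expn_gt0 //.
Qed.
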